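(* Let $G=(V,E)$ be a finite simple graph that is 3-balanced, with 3-balanced coloring $\ell:V\to\mathbb{Z}_3$. Then for all $i,j\in\mathbb{Z}_3$ with $i\not\equiv j$, \[ |E_{ij}|=\frac{2|E|}{9} \quad\text{and}\quad |E_{ii}|=\frac{|E|}{9}. \] In particular, $9\mid |E|$.
   Context: For a vertex coloring $\ell:V\to\mathbb{Z}_3$, write $V_i=\ell^{-1}(i)$ and $E_{ij}=\{vw\in E : \{\ell(v),\ell(w)\}=\{i,j\}\}$ for $i,j\in\mathbb{Z}_3$. A coloring $\ell:V\to\mathbb{Z}_3$ is (neighborhood) 3-balanced if for every vertex $v$ and all $i,j\in\mathbb{Z}_3$, $|N(v)\cap V_i|=|N(v)\cap V_j|$, where $N(v)$ is the open neighborhood of $v$. A graph is 3-balanced if it admits a 3-balanced coloring. *)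

(* Defs.v *)
From mathcomp Require Import all_boot all_order all_algebra.

Set Implicit Arguments.
Unset Strict Implicit.
Unset Printing Implicit Defensive.

(* A finite simple graph is a finite type V with a symmetric irreflexive
   adjacency relation e; an edge vw is the unordered pair [set v; w]. *)

Definition edges (V : finType) (e : rel V) : {set {set V}} :=
  [set [set v; w] | v in V, w in V & e v w].

Definition neighborhood (V : finType) (e : rel V) (v : V) : {set V} :=
  [set w | e v w].

Definition color_class (V : finType) (l : V -> 'Z_3) (i : 'Z_3) : {set V} :=
  l @^-1: [set i].

Definition edge_class (V : finType) (e : rel V) (l : V -> 'Z_3) (i j : 'Z_3) :
    {set {set V}} :=
  [set [set v; w] | v in V, w in V & e v w && ([set l v; l w] == [set i; j])].

Definition balanced3 (V : finType) (e : rel V) (l : V -> 'Z_3) : Prop :=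
  forall (v : V) (i j : 'Z_3),
    #|neighborhood e v :&: color_class l i| =
    #|neighborhood e v :&: color_class l j|.

(* Main.v *)
(** Let d(i,j) be the number of ordered adjacent pairs (v,w) with v coloured i
    and w coloured j. Balance makes d(i,j) independent of j, and symmetry of
    adjacency then makes it a constant c. Every edge gives two ordered pairs,
    so 2|E| = 9c, 2|E_ii| = c, and 2|E_ij| = d(i,j) + d(j,i) = 2c. *)

Require Import Defs.
From mathcomp Require Import all_boot all_order all_algebra.
Import Order.TTheory GRing.Theory Num.Theory.
Local Open Scope ring_scope.

Definition arcs {V : finType} (r : rel V) : {set V * V} :=
  [set p | r p.1 p.2].

(** As the image of a single set under one map, the edge set can be counted fibre by fibre. *)
Lemma edges_imset (V : finType) (r : rel V) :
  edges r = [set [set p.1; p.2] | p in arcs r].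
Proof.
apply/setP=> A; apply/imset2P/imsetP => [[v w _] | [[v w]]].
  by rewrite inE => /andP[_ rvw] ->; exists (v, w); rewrite ?inE.
by rewrite inE /= => rvw ->; exists v w; rewrite ?inE.
Qed.

Lemma set2_eq (V : finType) (a b c d : V) : a != b ->
  ([set c; d] == [set a; b]) =
  ((c == a) && (d == b)) || ((c == b) && (d == a)).
Proof.
move=> ab; apply/eqP/orP => [E | [] /andP[/eqP-> /eqP->] //]; last exact: setUC.
have ca : c \in [set a; b] by rewrite -E !inE eqxx.
have da : d \in [set a; b] by rewrite -E !inE eqxx orbT.
have ac : a \in [set c; d] by rewrite E !inE eqxx.
have bc : b \in [set c; d] by rewrite E !inE eqxx orbT.
move: ca da ac bc; rewrite !inE.
case/orP=> /eqP->; case/orP=> /eqP->; rewrite ?eqxx ?(negPf ab) //=; auto.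
by rewrite eq_sym (negPf ab).
Qed.

(** The fibre of [(v, w) |-> [set v; w]] over an edge consists of its two orientations, distinct
    since [r] has no loops. Keeping [r] general lets the count apply to all edges and to each edge
    class. *)
Lemma card_arcs_edges (V : finType) (r : rel V) :
  symmetric r -> irreflexive r -> #|arcs r| = (#|edges r| * 2)%N.
Proof.
move=> r_sym r_irr; rewrite edges_imset -sum1_card.
rewrite (partition_big_imset (fun p : V * V => [set p.1; p.2])) /=.
rewrite -sum_nat_const; apply: eq_bigr => _ /imsetP[[a b] + ->] /=.
rewrite inE /= => rab.
have ab : a != b by apply: contraTneq rab => ->; rewrite r_irr.
have <- : #|[set (a, b); (b, a)]| = 2%N.
  by rewrite cards2 xpair_eqE negb_and ab.
rewrite -sum1_card; apply: eq_bigl => -[c d].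
rewrite !inE /= set2_eq // !xpair_eqE.
(* A pair with the same endpoints as the arc [(a, b)] is itself an arc; the reversed one is so by
   symmetry. *)
apply: andb_idl => /orP[] /andP[/eqP-> /eqP->] //.
by rewrite r_sym.
Qed.

Definition color_arcs {V : finType} (e : rel V) (l : V -> 'Z_3) (i j : 'Z_3) :
    {set V * V} :=
  arcs (fun v w => [&& e v w, l v == i & l w == j]).

(** Grouping arcs by their tail brings in the neighbourhood counts that balance controls. *)
Lemma card_color_arcs (V : finType) (e : rel V) (l : V -> 'Z_3) (i j : 'Z_3) :
  #|color_arcs e l i j| =
  (\sum_(v | l v == i) #|neighborhood e v :&: color_class l j|)%N.
Proof.
under eq_bigr do rewrite -sum1_card.
rewrite pair_big_dep /= -sum1_card; apply: eq_bigl => -[v w].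
by rewrite !inE /= andbCA.
Qed.

Lemma card_color_arcsC (V : finType) (e : rel V) (l : V -> 'Z_3) (i j : 'Z_3) :
  symmetric e -> #|color_arcs e l i j| = #|color_arcs e l j i|.
Proof.
move=> e_sym; pose swap (p : V * V) := (p.2, p.1).
have swapK : involutive swap by case.
rewrite -(card_imset _ (inv_inj swapK)); apply: eq_card => -[v w].
rewrite -[(v, w)]swapK (mem_imset _ _ (inv_inj swapK)) !inE /=.
by rewrite e_sym [(l w == i) && _]andbC.
Qed.

(** Balance changes the head colour and reversal exchanges the two colours, so one passes through
    [(i, j)], [(i, i')], [(i', i)], [(i', j')]. *)
Lemma balanced3_color_arcs (V : finType) (e : rel V) (l : V -> 'Z_3) :
  symmetric e -> balanced3 e l ->
  forall i j i' j', #|color_arcs e l i j| = #|color_arcs e l i' j'|.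
Proof.
move=> e_sym l_bal.
have colr i j j' : #|color_arcs e l i j| = #|color_arcs e l i j'|.
  by rewrite !card_color_arcs; apply: eq_bigr => v _; apply: l_bal.
move=> i j i' j'.
by rewrite (colr i j i') card_color_arcsC // (colr i' i j').
Qed.

Lemma card_arcs_color (V : finType) (e : rel V) (l : V -> 'Z_3) :
  #|arcs e| = (\sum_(ij : 'Z_3 * 'Z_3) #|color_arcs e l ij.1 ij.2|)%N.
Proof.
rewrite -sum1_card.
rewrite (partition_big (fun p => (l p.1, l p.2)) xpredT) //=.
apply: eq_bigr => -[i j] _; rewrite -sum1_card; apply: eq_bigl => -[v w].
by rewrite !inE.
Qed.

(** The union handles both cases at once: it collapses to one set when [i = j] and is disjoint
    otherwise. *)
Lemma card_edge_class (V : finType) (e : rel V) (l : V -> 'Z_3) (i j : 'Z_3) :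
  symmetric e -> irreflexive e ->
  (#|edge_class e l i j| * 2)%N = #|color_arcs e l i j :|: color_arcs e l j i|.
Proof.
move=> e_sym e_irr.
pose r := [rel v w | e v w && ([set l v; l w] == [set i; j])].
(* By conversion, the class is the edge set of the subgraph [r], so its double counts the arcs of
   [r]. *)
rewrite -[edge_class e l i j]/(edges r) -card_arcs_edges; first last.
- by move=> v; rewrite /= e_irr.
- by move=> v w; rewrite /= e_sym setUC.
apply: eq_card => -[v w]; rewrite !inE /= -andb_orr; congr (_ && _).
have [->|ij] := eqVneq i j; last by rewrite set2_eq.
rewrite orbb setUid.
by rewrite eqEsubset subUset !sub1set !inE; case: eqP => //= ->; rewrite eqxx andbT.
Qed.

Theorem theorem3p2 (V : finType) (e : rel V)
    (e_sym : symmetric e) (e_irr : irreflexive e)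
    (l : V -> 'Z_3) (l_bal : balanced3 e l) :
  (forall i j : 'Z_3, i != j ->
     #|edge_class e l i j|%:R = 2 * #|edges e|%:R / 9 :> rat /\
     #|edge_class e l i i|%:R = #|edges e|%:R / 9 :> rat) /\
  (9 %| #|edges e|)%N.
Proof.
pose c := #|color_arcs e l 0 0|.
have cE i j : #|color_arcs e l i j| = c by apply: balanced3_color_arcs.
have total : (#|edges e| * 2 = 9 * c)%N.
  rewrite -card_arcs_edges // (card_arcs_color _ _ l).
  under eq_bigr do rewrite cE.
  by rewrite sum_nat_const card_prod card_ord.
have diag i : (#|edge_class e l i i| * 2 = c)%N.
  by rewrite card_edge_class // setUid cE.
have offdiag i j : i != j -> #|edge_class e l i j| = c.
  move=> ij; apply/eqP; rewrite -(eqn_pmul2r (isT : 0 < 2)%N).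
  rewrite card_edge_class // cardsU !cE muln2 -addnn.
  (* An arc in both sets would have a tail coloured both [i] and [j]. *)
  rewrite (_ : _ :&: _ = set0) ?cards0 ?subn0 //.
  apply/setP=> -[v w]; rewrite !inE /=.
  case: (eqVneq (l v) i) => [->|_]; last by rewrite andbF.
  by rewrite (negPf ij) !andbF.
(* Cancelling 2 in [2|E| = 9c = 9 * 2|E_ii|] yields the divisibility, and leaves every count a
   multiple of [|E_ii|]. *)
have edgesE i : #|edges e| = (9 * #|edge_class e l i i|)%N.
  by apply/eqP; rewrite -(eqn_pmul2r (isT : 0 < 2)%N) total -(diag i) mulnA.
split=> [i j ij|]; last by rewrite (edgesE 0) dvdn_mulr.
rewrite (offdiag i j ij) -(diag i) (edgesE i) !natrM.
by split; rewrite [9%:R * _]mulrC ?mulrA mulfK // mulrC.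
Qed.
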